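(* (1) Let $C$ be a (simply laced) Dynkin diagram, and let $Q$ be an oriented graph obtained from $C$ by choosing an orientation of every edge. Then $H_Q$ is finite. (2) Let $Q$ be a digraph of finite type, and let $C$ be the graph obtained from $Q$ by removing every arrow (keeping all vertices and all edges). Then $C$ is a (simply laced) Dynkin diagram.
   Context: A digraph $Q$ is a graph with at most one connection (side) between each pair of distinct vertices and no loops; each side is either an oriented arrow $i\to j$ or a non-oriented edge. An oriented graph is a digraph all of whose sides are arrows. The Hecke-Kiselman monoid $H_Q$ is the monoid generated by elements $a_i$, one for each vertex $i$ of $Q$, subject to the relations: $a_i^2=a_i$ for all $i$; $a_ia_j=a_ja_i$ if $i,j$ are not connected; $a_ia_ja_i=a_ja_ia_j$ if $i,j$ are connected by an edge; $a_ia_j=a_ia_ja_i=a_ja_ia_j$ if there is an arrow from $i$ to $j$. The digraph $Q$ is of finite type if $H_Q$ is finite. Here a simply laced Dynkin diagram means a finite graph, not necessarily connected, each of whose connected components is one of the diagrams $A_n$ ($n\ge1$), $D_n$ ($n\ge 4$), $E_6$, $E_7$, $E_8$. *)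

(* Defs.v *)
From HB Require Import structures.
From mathcomp Require Import all_boot.
From mathcomp Require Import boolp classical_sets cardinality.

Set Implicit Arguments.
Unset Strict Implicit.
Unset Printing Implicit Defensive.

Local Open Scope quotient_scope.
Local Open Scope classical_set_scope.

Record sgraph (V : Type) := SGraph {
  adj : rel V;
  adj_sym : symmetric adj;
  adj_irr : irreflexive adj
}.

Record digraph (V : Type) := Digraph {
  arrow : rel V;
  edge : rel V;
  edge_sym : symmetric edge;
  edge_irr : irreflexive edge;
  arrow_irr : irreflexive arrow;
  arrow_asym : forall i j, arrow i j -> ~~ arrow j i;
  arrow_edge : forall i j, arrow i j -> ~~ edge i j
}.

Definition connected (V : Type) (Q : digraph V) : rel V :=
  fun i j => [|| arrow Q i j, arrow Q j i | edge Q i j].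

Definition oriented (V : Type) (Q : digraph V) : Prop :=
  forall i j, ~~ edge Q i j.

Definition orientation_of (V : Type) (C : sgraph V) (Q : digraph V) : Prop :=
  oriented Q /\ forall i j, adj C i j = connected Q i j.

Definition remove_arrows (V : Type) (Q : digraph V) : sgraph V :=
  SGraph (edge_sym Q) (edge_irr Q).

Section HeckeKiselman.

Variables (V : choiceType) (Q : digraph V).

Inductive hk_relation : seq V -> seq V -> Prop :=
| HKidem i : hk_relation [:: i; i] [:: i]
| HKcomm i j : ~~ connected Q i j -> hk_relation [:: i; j] [:: j; i]
| HKbraid i j : edge Q i j -> hk_relation [:: i; j; i] [:: j; i; j]
| HKarrowl i j : arrow Q i j -> hk_relation [:: i; j] [:: i; j; i]
| HKarrowr i j : arrow Q i j -> hk_relation [:: i; j] [:: j; i; j].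

(* The congruence of the free monoid [seq V] generated by [hk_relation]. *)
Inductive hk_cong : seq V -> seq V -> Prop :=
| HKrel u v s t : hk_relation s t -> hk_cong (u ++ s ++ v) (u ++ t ++ v)
| HKrefl s : hk_cong s s
| HKsym s t : hk_cong s t -> hk_cong t s
| HKtrans s t r : hk_cong s t -> hk_cong t r -> hk_cong s r.

Definition hk_equiv : rel (seq V) := fun s t => `[< hk_cong s t >].

Lemma hk_equiv_refl : reflexive hk_equiv.
Proof. by move=> s; apply/asboolP/HKrefl. Qed.

Lemma hk_equiv_sym : symmetric hk_equiv.
Proof. by move=> s t; apply/asboolP/asboolP => /HKsym. Qed.

Lemma hk_equiv_trans : transitive hk_equiv.
Proof.
by move=> t s r /asboolP st /asboolP tr; apply/asboolP; apply: HKtrans st tr.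
Qed.

Canonical hk_equiv_rel :=
  EquivRel hk_equiv hk_equiv_refl hk_equiv_sym hk_equiv_trans.

Definition hk_monoid : Type := {eq_quot hk_equiv}.

HB.instance Definition _ := Choice.on hk_monoid.
HB.instance Definition _ := EqQuotient.on hk_monoid.

Lemma hk_piP (s t : seq V) : \pi_hk_monoid s = \pi_hk_monoid t <-> hk_cong s t.
Proof. by split=> [/eqmodP/asboolP | st]; last apply/eqmodP/asboolP. Qed.

Lemma hk_cong_cat (s1 s2 t1 t2 : seq V) :
  hk_cong s1 t1 -> hk_cong s2 t2 -> hk_cong (s1 ++ s2) (t1 ++ t2).
Proof.
move=> h1 h2; apply: (@HKtrans _ (t1 ++ s2)).
  elim: h1 => [u v s t st | s | s t _ | s t r _ IH1 _ IH2].
  - by rewrite -!catA; apply: HKrel.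
  - exact: HKrefl.
  - exact: HKsym.
  - exact: HKtrans IH1 IH2.
elim: h2 => [u v s t st | s | s t _ | s t r _ IH1 _ IH2].
- by rewrite !(catA t1); apply: HKrel.
- exact: HKrefl.
- exact: HKsym.
- exact: HKtrans IH1 IH2.
Qed.

Definition hk_one : hk_monoid := \pi_hk_monoid [::].

Definition hk_mul (x y : hk_monoid) : hk_monoid :=
  \pi_hk_monoid (repr x ++ repr y).

Lemma hk_mul_pi (s t : seq V) :
  hk_mul (\pi_hk_monoid s) (\pi_hk_monoid t) = \pi_hk_monoid (s ++ t).
Proof. by apply/hk_piP; apply: hk_cong_cat; apply/hk_piP; rewrite reprK. Qed.

Lemma hk_mulA : associative hk_mul.
Proof.
elim/quotW=> r; elim/quotW=> s; elim/quotW=> t.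
by rewrite (hk_mul_pi s t) (hk_mul_pi r s) (hk_mul_pi r (s ++ t))
           (hk_mul_pi (r ++ s) t) catA.
Qed.

Lemma hk_mul1 : left_id hk_one hk_mul.
Proof. by elim/quotW=> s; rewrite (hk_mul_pi [::] s). Qed.

Lemma hk_mulr1 : right_id hk_one hk_mul.
Proof. by elim/quotW=> s; rewrite (hk_mul_pi s [::]) cats0. Qed.

HB.instance Definition _ :=
  isMonoid.Build hk_monoid hk_mulA hk_mul1 hk_mulr1.

Definition hk_gen (i : V) : hk_monoid := \pi_hk_monoid [:: i].

Definition finite_type : Prop := finite_set [set: hk_monoid].

End HeckeKiselman.

(* The path 0 - 1 - ... - (n-1). *)
Definition adjA (n : nat) : rel 'I_n :=
  fun i j => (i.+1 == j :> nat) || (j.+1 == i :> nat).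

(* The path 0 - 1 - ... - (n-2), with vertex n-1 attached to vertex k only. *)
Definition adj_branch (n k : nat) : rel 'I_n := fun i j =>
  let e (a b : nat) :=
    ((a.+1 == b) && (b < n.-1)) || ((a == k) && (b == n.-1)) in
  e i j || e j i.

(* In D_n the extra vertex is attached to the penultimate vertex of the path; *)
(* in E_n, to the third one, giving arms of lengths 2, n - 4 and 1.           *)
Inductive dynkin_diagram : forall n : nat, rel 'I_n -> Prop :=
| DynkinA n : 1 <= n -> dynkin_diagram (@adjA n)
| DynkinD n : 4 <= n -> dynkin_diagram (@adj_branch n (n - 3))
| DynkinE6 : dynkin_diagram (@adj_branch 6 2)
| DynkinE7 : dynkin_diagram (@adj_branch 7 2)
| DynkinE8 : dynkin_diagram (@adj_branch 8 2).

Definition component (V : Type) (C : sgraph V) (x : V) : set V :=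
  [set y | exists p : seq V, path (adj C) x p /\ last x p = y].

(* The subgraph of [C] induced on [K] is isomorphic to the graph [e]. *)
Definition induced_iso (V : Type) (C : sgraph V) (K : set V)
    (n : nat) (e : rel 'I_n) : Prop :=
  exists f : 'I_n -> V,
    [/\ injective f, range f = K & forall i j, adj C (f i) (f j) = e i j].

Definition dynkin (V : Type) (C : sgraph V) : Prop :=
  finite_set [set: V] /\
  forall x : V, exists (n : nat) (e : rel 'I_n),
    dynkin_diagram e /\ induced_iso C (component C x) e.

(* Main.v *)
Require Import Defs.
From mathcomp Require Import all_boot.
From mathcomp Require Import boolp classical_sets cardinality.
From mathcomp Require Import zify.

(* Part (1). In a shortest word, two occurrences of [i] enclose both an in-neighbour and an
   out-neighbour of [i], since otherwise one of the two letters is absorbed. A Dynkin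
   diagram can be numbered so that each vertex has at most one neighbour of smaller number;
   hence consecutive occurrences of [i] enclose a neighbour of larger number, which bounds
   the number of occurrences of each letter by downward induction on the numbering.

   Part (2). The numbers game: the Hecke-Kiselman monoid acts on functions [c : V -> nat],
   the generator [i] replacing [c i] by the maximum of [c i] and
   [1 + (sum of c over the edge-neighbours of i) - c i]. These moves only increase [c], so
   when the monoid is finite the orbit of [0] contains a common fixed point, that is, a [c]
   with [2 c i > (sum of c over the edge-neighbours of i)] for every [i]. Such a strictly
   subadditive function rules out every affine diagram as a subgraph, so each component is
   a path or a tripod with arms of the lengths allowed in types D and E. *)

Set Implicit Arguments.
Unset Strict Implicit.
Unset Printing Implicit Defensive.

(** * Absorption of repeated letters over an oriented graph *)

Section Absorption.

Variables (V : choiceType) (Q : digraph V).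
Hypothesis oriQ : oriented Q.

Lemma hk_cong_ctx (u v s t : seq V) :
  hk_cong Q s t -> hk_cong Q (u ++ s ++ v) (u ++ t ++ v).
Proof.
move=> st; apply: hk_cong_cat; first exact: HKrefl.
by apply: hk_cong_cat => //; exact: HKrefl.
Qed.

Lemma hk_cong_relation (s t : seq V) : hk_relation Q s t -> hk_cong Q s t.
Proof. by move=> /(HKrel [::] [::]); rewrite /= !cats0. Qed.

(** Either there is an arrow from [i] to [j], and this is a defining relation, or no side joins the
    letters, so they commute and idempotency of [i] suffices. *)
Lemma hk_cong_dup_left i j :
  ~~ arrow Q j i -> hk_cong Q [:: i; j] [:: i; j; i].
Proof.
move=> nji; have [ij|nij] := boolP (arrow Q i j).
  exact/hk_cong_relation/HKarrowl.
have ii : hk_cong Q [:: i; i] [:: i] by exact/hk_cong_relation/HKidem.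
have cij : hk_cong Q [:: i; j] [:: j; i].
  by apply/hk_cong_relation/HKcomm; rewrite /connected !negb_or nij nji oriQ.
apply: (@HKtrans _ _ _ [:: i; i; j]).
  exact: HKsym (hk_cong_ctx [::] [:: j] ii).
exact: (hk_cong_ctx [:: i] [::] cij).
Qed.

Lemma hk_cong_dup_right i j :
  ~~ arrow Q i j -> hk_cong Q [:: j; i] [:: i; j; i].
Proof.
move=> nij; have [ji|nji] := boolP (arrow Q j i).
  exact/hk_cong_relation/HKarrowr.
have ii : hk_cong Q [:: i; i] [:: i] by exact/hk_cong_relation/HKidem.
have cji : hk_cong Q [:: j; i] [:: i; j].
  by apply/hk_cong_relation/HKcomm; rewrite /connected !negb_or nij nji oriQ.
apply: (@HKtrans _ _ _ [:: j; i; i]).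
  exact: HKsym (hk_cong_ctx [:: j] [::] ii).
exact: (hk_cong_ctx [::] [:: i] cji).
Qed.

(** The leading [i] can be copied past each letter of [u] in turn; the last copy merges with the
    final [i] by idempotency, and the other copies are then withdrawn. *)
Lemma hk_cong_absorb_left i u :
  {in u, forall j, ~~ arrow Q j i} -> hk_cong Q (i :: u ++ [:: i]) (i :: u).
Proof.
elim: u => [_|j u IH nu]; first exact/hk_cong_relation/HKidem.
have dup := hk_cong_dup_left (nu j (mem_head _ _)).
apply: (@HKtrans _ _ _ ([:: i; j; i] ++ (u ++ [:: i]))).
  exact: (hk_cong_ctx [::] (u ++ [:: i]) dup).
apply: (@HKtrans _ _ _ ([:: i; j] ++ (i :: u))).
  have := hk_cong_ctx [:: i; j] [::] (IH _).
  by rewrite !cats0; apply=> k ku; apply: nu; rewrite inE ku orbT.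
exact: HKsym (hk_cong_ctx [::] u dup).
Qed.

Lemma hk_cong_absorb_right i u :
  {in u, forall j, ~~ arrow Q i j} -> hk_cong Q (i :: u ++ [:: i]) (u ++ [:: i]).
Proof.
elim/last_ind: u => [_|u j IH nu]; first exact/hk_cong_relation/HKidem.
have dup : hk_cong Q [:: j; i] [:: i; j; i].
  by apply: hk_cong_dup_right; apply: nu; rewrite mem_rcons mem_head.
rewrite -cats1 -catA /=.
apply: (@HKtrans _ _ _ ((i :: u ++ [:: i]) ++ [:: j; i])).
  by have := hk_cong_ctx (i :: u) [::] dup; rewrite !cats0 /= -catA.
apply: (@HKtrans _ _ _ ((u ++ [:: i]) ++ [:: j; i])).
  apply: (hk_cong_ctx [::] [:: j; i]) (IH _) => k ku.
  by apply: nu; rewrite mem_rcons inE ku orbT.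
by have := HKsym (hk_cong_ctx u [::] dup); rewrite !cats0 -catA.
Qed.

Definition reduced (s : seq V) : Prop :=
  forall t, hk_cong Q s t -> size s <= size t.

Lemma exists_reduced s : exists2 t, hk_cong Q s t & reduced t.
Proof.
pose P n := `[< exists2 t, hk_cong Q s t & size t = n >].
have exP : exists n, P n by exists (size s);
  apply/asboolP; exists s => //; exact: HKrefl.
have [n /asboolP[t st <-] minn] := ex_minnP exP.
exists t => // r tr; apply: minn; apply/asboolP; exists r => //.
exact: HKtrans tr.
Qed.

Lemma reduced_between i p u q : reduced (p ++ i :: u ++ i :: q) ->
  (exists2 j, j \in u & arrow Q j i) /\ (exists2 j, j \in u & arrow Q i j).
Proof.
move=> red; split; apply/hasP; apply: contraT => /hasPn nu.
- have := hk_cong_ctx p q (hk_cong_absorb_left nu).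
  by rewrite /= -catA => /red; rewrite !size_cat /= !size_cat /=; lia.
- have := hk_cong_ctx p q (hk_cong_absorb_right nu).
  by rewrite /= -catA => /red; rewrite !size_cat /= !size_cat /=; lia.
Qed.

End Absorption.

(** * Letter counts in reduced words over an oriented Dynkin diagram *)

Lemma count_mem_le_between (T : eqType) (i : T) (A : pred T) (s : seq T) :
  (forall p u q, s = p ++ i :: u ++ i :: q -> has A u) ->
  count_mem i s <= (count A s).+1.
Proof.
have [n] := ubnP (size s); elim: n s => // n IH [//|x s] /= sz bet.
have [/eqP xi|xi] := boolP (x == i); last first.
  apply: leq_trans (IH s _ _) _; [lia| |lia].
  by move=> p u q es; apply: (bet (x :: p) u q); rewrite es.
have [si|/count_memPn -> //] := boolP (i \in s).
(* Cutting at the next occurrence of [i] isolates one gap, [take k s], which supplies a letter in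
   [A]; the induction resumes from that occurrence. *)
pose k := index i s; have ks : k < size s by rewrite index_mem.
have es : s = take k s ++ i :: drop k.+1 s.
  by rewrite -[LHS](cat_take_drop k) (drop_nth i) // nth_index.
have iu : count_mem i (take k s) = 0.
  by apply/count_memPn; rewrite in_take ?ltnn // index_size.
have := bet [::] (take k s) (drop k.+1 s); rewrite xi -es => /(_ erefl).
rewrite has_count => Au.
have := IH (i :: drop k.+1 s); rewrite /= size_drop eqxx => IHd.
rewrite es !count_cat iu /= eqxx.
have : (1 + count_mem i (drop k.+1 s) <= (A i + count A (drop k.+1 s)).+1).
  apply: IHd => [|p u q ed]; first lia.
  by apply: (bet (x :: take k s ++ p) u q); rewrite /= -catA -ed -es.
lia.
Qed.

(** A path vertex has at most its predecessor below it, and the vertex off the path comes last and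
    has a single neighbour. *)
Lemma dynkin_diagram_lower_unique n (e : rel 'I_n) (i j k : 'I_n) :
  dynkin_diagram e -> e i j -> e i k -> j < i -> k < i -> j = k.
Proof.
move=> de; move: i j k.
case: n e / de => [n n1|n n4|||] i j k; rewrite /adjA /adj_branch /= => eij eik ji ki;
  apply: val_inj => /=; move: eij eik ji ki (ltn_ord i) (ltn_ord j) (ltn_ord k); lia.
Qed.

Lemma finite_set_enum (T : choiceType) :
  finite_set [set: T] -> exists2 E : seq T, uniq E & forall x, x \in E.
Proof.
move=> /finite_seqP[E TE]; exists (undup E); first exact: undup_uniq.
move=> x; rewrite mem_undup.
have : [set: T]%classic x by [].
by rewrite TE.
Qed.

Lemma size_sum_count (T : eqType) (E s : seq T) : uniq E -> {subset s <= E} ->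
  size s = \sum_(x <- E) count_mem x s.
Proof.
move=> uE; elim: s => [|y s IH] sE; first by rewrite big1_eq.
rewrite /= big_split /= -IH => [|x xs]; last by apply: sE; rewrite inE xs orbT.
rewrite (eq_bigr (fun x => if x == y then 1 else 0)) => [|x _]; last first.
  by rewrite eq_sym; case: eqP.
by rewrite -big_mkcond sum1_count (count_uniq_mem y uE) sE ?mem_head.
Qed.

Fixpoint words (T : Type) (E : seq T) (n : nat) : seq (seq T) :=
  if n is m.+1 then [::] :: [seq x :: w | x <- E, w <- words E m]
  else [:: [::]].

Lemma mem_words (T : eqType) (E : seq T) (n : nat) (s : seq T) :
  {subset s <= E} -> size s <= n -> s \in words E n.
Proof.
elim: n s => [|n IH] [|x s] //= sE; rewrite ltnS => sn.
rewrite inE /=; apply/allpairsP; exists (x, s); split => //=.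
  by apply: sE; rewrite mem_head.
by apply: IH => // y ys; apply: sE; rewrite inE ys orbT.
Qed.

Section FiniteOrientation.

Variables (V : choiceType) (C : sgraph V) (Q : digraph V).
Hypothesis dynC : dynkin C.
Hypothesis oriQ : orientation_of C Q.

Lemma reduced_count_bounded (x : V) :
  exists B, forall s, reduced Q s -> count_mem x s <= B.
Proof.
have [n [e [de [f [injf rf fe]]]]] := dynC.2 x.
have in_f y : component C x y -> exists i, f i = y.
  by rewrite -rf => -[i _ <-]; exists i.
(* The [k] vertices of largest number in the component. The next vertex occurs at most once more
   often than all of these together, so the count at most doubles plus one at each step, whence
   [2 ^ k - 1]. *)
pose upper k := [pred y | [exists i : 'I_n, (n - k <= i) && (f i == y)]].
have bound k : k <= n -> forall s, reduced Q s -> count (upper k) s < 2 ^ k.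
  elim: k => [_ s _|k IH kn s reds].
    rewrite (@eq_count _ _ pred0) ?count_pred0 // => y /=.
    by apply/existsP => -[i]; have := ltn_ord i; lia.
  have lt_nk : n - k.+1 < n by lia.
  pose i := Ordinal lt_nk.
  have upS : count (upper k.+1) s <= count_mem (f i) s + count (upper k) s.
    rewrite -count_predUI; apply: leq_trans (leq_addr _ _).
    apply: sub_count => y /= /existsP[j /andP[nkj /eqP fj]].
    have [ji|nji] := eqVneq j i; first by rewrite -fj ji eqxx.
    apply/orP; right; apply/existsP; exists j; rewrite fj eqxx andbT.
    by move: nji; rewrite -val_eqE /=; lia.
  (* A neighbour of [f i] stays in the component of [x], so it is numbered too. *)
  have neighbour u j : j \in u -> connected Q j (f i) ->
      exists2 l, j = f l & e l i.
    move=> ju cji; have adji : adj C j (f i) by rewrite oriQ.2.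
    have [l fl] : exists l, f l = j.
      apply: in_f; have [p [pp lp]] : component C x (f i) by rewrite -rf; exists i.
      exists (rcons p j); rewrite last_rcons rcons_path pp lp; split=> //.
      by rewrite /= adj_sym.
    by exists l; rewrite -?fe ?fl.
  have := IH (ltnW kn) s reds.
  have : count_mem (f i) s <= (count (upper k) s).+1.
    apply: count_mem_le_between => p u q es; move: reds; rewrite es => reds.
    have [[a au arr_a] [b bu arr_b]] := reduced_between oriQ.1 reds.
    have [l el eli] : exists2 l, a = f l & e l i.
      by apply: neighbour au _; rewrite /connected arr_a.
    have [m em emi] : exists2 m, b = f m & e m i.
      by apply: neighbour bu _; rewrite /connected arr_b orbT.
    (* Asymmetry of arrows separates the in-neighbour from the out-neighbour. Two distinct
       neighbours cannot both be numbered below [i], so one of them lies in [upper k]. *)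
    have lm : l != m.
      apply: contraNneq (arrow_asym arr_a) => lm.
      by rewrite el lm -em.
    have esym a' b' : e a' b' = e b' a' by rewrite -!fe adj_sym.
    have enn a' : e a' a' = false by rewrite -fe adj_irr.
    have [il|li] := ltnP i l.
      apply/hasP; exists a => //=; apply/existsP; exists l.
      by rewrite el eqxx andbT; move: il => /=; lia.
    have [im|mi] := ltnP i m.
      apply/hasP; exists b => //=; apply/existsP; exists m.
      by rewrite em eqxx andbT; move: im => /=; lia.
    have ltl : l < i.
      by rewrite ltn_neqAle li andbT val_eqE; apply: contraTneq eli => ->; rewrite enn.
    have ltm : m < i.
      by rewrite ltn_neqAle mi andbT val_eqE; apply: contraTneq emi => ->; rewrite enn.
    by move: lm; rewrite (dynkin_diagram_lower_unique de _ _ ltl ltm) ?eqxx // esym.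
  by rewrite expnS; lia.
have [i fi] := in_f x (ex_intro _ [::] (conj isT erefl)).
exists (2 ^ n) => s reds; apply: leq_trans (ltnW (bound n (leqnn n) s reds)).
apply: sub_count => y /= /eqP ->; apply/existsP; exists i.
by rewrite subnn fi eqxx.
Qed.

(** Every class contains a reduced word, whose length is at most the sum of the letter bounds; there
    are finitely many such words. *)
Lemma finite_type_of_dynkin : finite_type Q.
Proof.
have [E uE memE] := finite_set_enum dynC.1.
have [B bB] := choice reduced_count_bounded.
pose N := \sum_(x <- E) B x.
apply: (@sub_finite_set _ _ [set` [seq \pi_(hk_monoid Q)%qT w | w <- words E N]]).
  move=> + _; elim/quotW => s /=.
  have [t st redt] := exists_reduced Q s.
  apply/mapP; exists t; last exact/hk_piP.
  apply: mem_words => [y _|]; first exact: memE.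
  rewrite (size_sum_count uE) => [|y _]; last exact: memE.
  by apply: leq_sum => x _; apply: bB.
exact: finite_seq.
Qed.

End FiniteOrientation.

Lemma exists_max (T : Type) (P : T -> Prop) (m : T -> nat) (B : nat) (t0 : T) :
  P t0 -> (forall t, P t -> m t <= B) ->
  exists2 t, P t & forall t', P t' -> m t' <= m t.
Proof.
move=> Pt0 mB; pose p n := `[< exists2 t, P t & m t = n >].
have exp : exists n, p n by exists (m t0); apply/asboolP; exists t0.
have pB n : p n -> n <= B by move=> /asboolP[t /mB + <-].
have [n /asboolP[t Pt <-] maxn] := ex_maxnP exp pB.
by exists t => // t' Pt'; apply: maxn; apply/asboolP; exists t'.
Qed.

(** * The numbers game as an action of the monoid *)

Section Firing.

Variables (V : choiceType) (Q : digraph V) (E : seq V).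
Hypotheses (uE : uniq E) (memE : forall x, x \in E).

Definition nbsum (c : V -> nat) (i : V) := \sum_(j <- E | edge Q i j) c j.

(** The reflection in coordinate [i], shifted by one and applied only when it raises the value. The
    maximum makes truncated subtraction harmless. *)
Definition fire (i : V) (c : V -> nat) : V -> nat :=
  fun v => if v == i then maxn (c i) ((nbsum c i).+1 - c i) else c v.

Lemma eq_nbsum c d i : (forall j, edge Q i j -> c j = d j) ->
  nbsum c i = nbsum d i.
Proof. by move=> cd; apply: eq_bigr. Qed.

(** Without loops the neighbour sum ignores the value at [i], and reflecting again would restore the
    old value, which is no larger. *)
Lemma fire_idem i c : fire i (fire i c) = fire i c.
Proof.
apply: functional_extensionality_dep => v; rewrite /fire eqxx.
have -> : nbsum (fun v => if v == i then maxn (c i) ((nbsum c i).+1 - c i) else c v) i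
    = nbsum c i.
  by apply: eq_nbsum => j ij; case: eqP ij => // ->; rewrite edge_irr.
by case: eqP => // _; lia.
Qed.

Lemma fire_comm i j c : ~~ edge Q i j -> fire i (fire j c) = fire j (fire i c).
Proof.
have nb a b : ~~ edge Q a b -> nbsum (fire b c) a = nbsum c a.
  move=> nab; apply: eq_nbsum => k ak; rewrite /fire.
  by case: eqP ak nab => // -> ->.
move=> nij; have nji : ~~ edge Q j i by rewrite edge_sym.
apply: functional_extensionality_dep => v.
rewrite {1}/fire nb // [RHS]/fire nb //.
rewrite /fire; case: (eqVneq i j) => [->|nEij]; first by [].
case: (eqVneq v i) => [->|//]; by rewrite (negPf nEij).
Qed.

(** Only coordinates [i] and [j] move, while the sums over their other neighbours stay fixed; what
    remains is a max-plus identity in four numbers. *)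
Lemma fire_braid i j c : edge Q i j ->
  fire i (fire j (fire i c)) = fire j (fire i (fire j c)).
Proof.
move=> ij; have ji : edge Q j i by rewrite edge_sym.
have nij : i != j by apply: contraTneq ij => ->; rewrite edge_irr.
pose st p q v := if v == i then p else if v == j then q else c v.
pose rest a b := \sum_(k <- E | edge Q a k && (k != b)) c k.
have sti p q : st p q i = p by rewrite /st eqxx.
have stj p q : st p q j = q by rewrite /st eqxx eq_sym (negPf nij).
have nbi p q : nbsum (st p q) i = q + rest i j.
  rewrite /nbsum -big_filter (bigD1_seq j) ?mem_filter ?filter_uniq ?ij ?memE //=.
  rewrite big_filter_cond stj; congr addn.
  apply: eq_bigr => k /andP[ik kj]; rewrite /st (negPf kj).
  by case: eqP ik => // ->; rewrite edge_irr.
have nbj p q : nbsum (st p q) j = p + rest j i.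
  rewrite /nbsum -big_filter (bigD1_seq i) ?mem_filter ?filter_uniq ?ji ?memE //=.
  rewrite big_filter_cond sti; congr addn.
  apply: eq_bigr => k /andP[jk ki]; rewrite /st (negPf ki).
  by case: eqP jk => // ->; rewrite edge_irr.
have firei p q : fire i (st p q) = st (maxn p ((q + rest i j).+1 - p)) q.
  apply: functional_extensionality_dep => v.
  by rewrite /fire nbi sti /st; case: eqP.
have firej p q : fire j (st p q) = st p (maxn q ((p + rest j i).+1 - q)).
  apply: functional_extensionality_dep => v.
  rewrite /fire nbj stj /st; case: eqP => // ->.
  by rewrite eq_sym (negPf nij).
have -> : c = st (c i) (c j).
  apply: functional_extensionality_dep => v; rewrite /st.
  by case: eqP => [->//|_]; case: eqP => [->|].
by rewrite !(firei, firej); congr st; lia.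
Qed.

Definition act (s : seq V) (c : V -> nat) := foldr fire c s.

Lemma hk_cong_act s t c : hk_cong Q s t -> act s c = act t c.
Proof.
move=> st; elim: st c => {s t} [u v s t st|s|s t _ IH|s t r _ IH1 _ IH2] c //;
  last by rewrite IH1.
rewrite /act !foldr_cat; congr (foldr _ _ _).
move: (foldr fire c v) => {}c; case: st => /=.
- by move=> i; exact: fire_idem.
- move=> i j; rewrite /connected !negb_or => /and3P[_ _]; exact: fire_comm.
- by move=> i j; exact: fire_braid.
(* An arrow excludes an edge and [fire] ignores arrows, so the two moves commute; idempotency then
   gives both arrow relations. *)
- move=> i j aij; have ij := arrow_edge aij.
  by rewrite -(fire_comm c ij) fire_idem.
- move=> i j aij; have ij := arrow_edge aij.
  by rewrite (fire_comm _ ij) fire_idem.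
Qed.

(* A state of maximal total weight in the orbit of [0] is fixed by every
   [fire i]. *)
Lemma subadditive_of_finite_type : finite_type Q ->
  exists c : V -> nat, forall i, nbsum c i < 2 * c i.
Proof.
move=> finQ.
have [W _ memW] := finite_set_enum finQ.
pose wt (c : V -> nat) := \sum_(x <- E) c x.
pose wtw s := wt (act s (fun => 0)).
(* The weight depends only on the class of the word, so the sum over representatives of the finitely
   many classes bounds it. *)
have wtB s : True -> wtw s <= \sum_(x <- W) wtw (repr x).
  move=> _; set x := (\pi_(hk_monoid Q) s)%qT.
  have -> : wtw s = wtw (repr x).
    rewrite /wtw; congr wt; apply: hk_cong_act.
    by apply/hk_piP; rewrite reprK.
  by rewrite (big_rem x) //= leq_addr.
have [s _ maxs] := exists_max (t0 := [::]) I wtB.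
exists (act s (fun => 0)) => i; set c := act s _.
(* By maximality [fire i] does not raise [c i], that is, [(nbsum c i).+1 - c i <= c i]. *)
have := maxs (i :: s) I; rewrite /wtw /= -/c /wt.
rewrite (bigD1_seq i) //= [X in _ <= X](bigD1_seq i) //=.
rewrite (eq_bigr c) => [|k /negPf ki]; last by rewrite /fire ki.
by rewrite leq_add2r /fire eqxx; lia.
Qed.

End Firing.

(** * Finiteness of the vertex set *)

Lemma hk_cong_mem (V : choiceType) (Q : digraph V) (s t : seq V) :
  hk_cong Q s t -> s =i t.
Proof.
elim=> {s t} [u v s t st|s|s t _ IH|s t r _ IH1 _ IH2] x //; last first.
  by rewrite IH1.
rewrite !mem_cat; congr [|| _, _ | _].
by case: st => *; rewrite !inE; do !case: eqP.
Qed.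

(** Congruent words have the same letters, so the representative of the generator [i] contains [i];
    finitely many representatives contain every vertex. *)
Lemma finite_vertices (V : choiceType) (Q : digraph V) :
  finite_type Q -> finite_set [set: V].
Proof.
move=> /finite_set_enum[W _ memW].
apply: (@sub_finite_set _ _ [set` flatten [seq repr x | x <- W]]).
  move=> i _ /=; apply/flattenP; exists (repr (hk_gen Q i)); first exact: map_f.
  by rewrite -(@hk_cong_mem _ Q [:: i]) ?mem_head //; apply/hk_piP; rewrite reprK.
exact: finite_seq.
Qed.

(** Turns distinctness in rearranged concatenations into linear inequalities on counts, which [lia]
    settles. *)
Lemma uniq_countP (T : eqType) (s : seq T) :
  reflect (forall x, count_mem x s <= 1) (uniq s).
Proof.
apply: (iffP idP) => [us x|]; first by rewrite count_uniq_mem ?leq_b1.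
elim: s => //= y s IH cs; rewrite IH => [|x];
  last by apply: leq_trans (cs x); rewrite leq_addl.
by rewrite andbT; apply/count_memPn; have := cs y; rewrite eqxx; lia.
Qed.

(** * Subgraphs excluded by a strictly subadditive function *)

Section Subadditive.

Variables (V : choiceType) (C : sgraph V) (E : seq V) (c : V -> nat).
Hypotheses (uE : uniq E) (memE : forall x, x \in E).
Hypothesis subadd : forall i, \sum_(j <- E | adj C i j) c j < 2 * c i.

Lemma adjC x y : adj C x y = adj C y x.
Proof. exact: adj_sym. Qed.

Lemma adj_neq x y : adj C x y -> x != y.
Proof. by apply: contraTneq => ->; rewrite adj_irr. Qed.

Lemma subadd_seq i l : uniq l -> all (adj C i) l -> \sum_(j <- l) c j < 2 * c i.
Proof.
move=> ul /allP al; apply: leq_ltn_trans (subadd i).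
rewrite (perm_big [seq j <- E | j \in l]); last first.
  apply: uniq_perm => //; first exact: filter_uniq.
  by move=> j; rewrite mem_filter memE andbT.
rewrite big_filter big_mkcond [X in _ <= X]big_mkcond /=.
by apply: leq_sum => j _; case: ifP => // /al ->.
Qed.

(** Excludes the affine diagrams An~: at a vertex of least weight on the cycle, its two cycle
    neighbours already weigh twice as much together. *)
Lemma no_cycle s : uniq s -> 2 < size s -> ~~ cycle (adj C) s.
Proof.
move=> us ss; apply/negP => cs.
pose P n := has (fun x => c x == n) s.
have exP : exists n, P n.
  by rewrite /P; case: s us ss cs {P} => // x s _ _ _; exists (c x); rewrite /= eqxx.
have [_ /hasP[x xs /eqP <-] minx] := ex_minnP exP.
have [k t rs] := rot_to xs.
have cmin y : y \in t -> c x <= c y.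
  move=> yt; apply: minx; apply/hasP; exists y => //.
  by rewrite -(mem_rot k) rs inE yt orbT.
move: cs us ss; rewrite -(rot_cycle k) -(rot_uniq k) -(size_rot k) rs.
case: t cmin {rs} => [|y t] // cmin; case/lastP: t cmin => [|t w] // cmin.
rewrite /= !rcons_path last_rcons => /and3P[xy _ wx].
case/and3P=> _ + _ _; rewrite mem_rcons inE negb_or => /andP[yw _].
have := @subadd_seq x [:: y; w]; rewrite /= !big_cons big_nil xy adjC wx inE yw.
move=> /(_ isT isT); have := cmin y (mem_head _ _).
have := cmin w; rewrite inE mem_rcons mem_head orbT => /(_ isT); lia.
Qed.

(** The chord would close the part of the path up to [w] into a cycle. *)
Lemma path_no_chord a b s w : path (adj C) a (b :: s) -> uniq [:: a, b & s] ->
  w \in s -> adj C a w = false.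
Proof.
move=> + + ws; case/splitPr: ws => p1 p2.
rewrite -cat_rcons -!cat_cons cat_path cat_uniq => /andP[pab _] /andP[uab _].
apply: contraTF uab => aw; apply: contraL pab => uab.
have := no_cycle uab; rewrite /= size_rcons => /(_ isT).
by rewrite !rcons_path last_rcons [adj C w a]adjC aw andbT.
Qed.

Lemma line_adj x0 L i j : sorted (adj C) L -> uniq L -> i < size L -> j < size L ->
  adj C (nth x0 L i) (nth x0 L j) = (i.+1 == j) || (j.+1 == i).
Proof.
move=> sL uL; wlog ij : i j / i < j => [W iL jL|].
  case: (ltngtP i j) => [ij|ji|->]; [exact: W| |].
    by rewrite adjC orbC; apply: W.
  by rewrite adj_irr; lia.
move=> iL jL; have -> : (j.+1 == i) = false by lia.
rewrite orbF; have iL1 : i.+1 < size L by lia.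
case: eqP => [<-|/eqP nij]; first by move/sortedP: sL; apply.
have dL : drop i L = [:: nth x0 L i, nth x0 L i.+1 & drop i.+2 L].
  by rewrite (drop_nth x0) // (drop_nth x0).
apply: (@path_no_chord _ (nth x0 L i.+1) (drop i.+2 L)).
- by have := drop_sorted i sL; rewrite dL.
- by rewrite -dL drop_uniq.
- have -> : j = i.+2 + (j - i.+2) by lia.
  rewrite -nth_drop mem_nth // size_drop ltn_sub2r //; apply: leq_ltn_trans jL; lia.
Qed.

(* Weights strictly decrease along the path after the first step, by concavity;
   branching at the far end would force them to increase. *)
Lemma no_descent_to_branch y x p w v :
  path (adj C) x p -> adj C x y -> c x < c y -> uniq (y :: x :: p ++ [:: w; v]) ->
  adj C (last x p) w -> adj C (last x p) v -> False.
Proof.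
elim: p y x => [|x' p IH] y x.
  move=> _ xy cxy /uniq_countP u xw xv.
  have := @subadd_seq x [:: y; w; v]; have := @subadd_seq w [:: x].
  have := @subadd_seq v [:: x].
  rewrite /= !big_cons !big_nil ![adj C _ x]adjC xy xw xv => /(_ isT isT) ? /(_ isT isT) ?.
  have uy : uniq [:: y; w; v] by apply/uniq_countP => t; have := u t => /=; lia.
  by move=> /(_ uy isT); lia.
move=> /andP[xx' px'] xy cxy /uniq_countP u xw xv.
have := @subadd_seq x [:: y; x']; rewrite /= !big_cons big_nil xy xx'.
have uy : uniq [:: y; x'].
  by apply/uniq_countP => t; have := u t => /=; lia.
move=> /(_ uy isT) cx.
apply: (IH x x') => //; [by rewrite adjC|lia|].
by apply/uniq_countP => t; have := u t => /=; lia.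
Qed.

(* Excludes the affine diagrams Dn~. *)
Lemma no_double_branch h1 h2 x p w v :
  path (adj C) x p -> adj C x h1 -> adj C x h2 ->
  uniq (h1 :: h2 :: x :: p ++ [:: w; v]) ->
  adj C (last x p) w -> adj C (last x p) v -> False.
Proof.
move=> px xh1 xh2 u lw lv.
have leaf h : adj C x h -> c x < 2 * c h.
  move=> xh; have := @subadd_seq h [:: x].
  by rewrite /= big_seq1 adjC xh; apply.
have := leaf _ xh1; have := leaf _ xh2; move/uniq_countP: u => u.
case: p px u lw lv => [_ u xw xv|x' p /= /andP[xx' px] u lw lv] l2 l1.
  have := @subadd_seq x [:: h1; h2; w; v].
  rewrite /= !big_cons big_nil xh1 xh2 xw xv.
  have uy : uniq [:: h1; h2; w; v].
    by apply/uniq_countP => t; have := u t => /=; lia.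
  by move=> /(_ uy isT); have := leaf _ xw; have := leaf _ xv; lia.
(* Both [2 * c h1] and [2 * c h2] exceed [c x], so [c h1 + c h2 > c x]; hence [c x' < c x] and the
   descent starts. *)
have := @subadd_seq x [:: h1; h2; x']; rewrite /= !big_cons big_nil xh1 xh2 xx'.
have uy : uniq [:: h1; h2; x'].
  by apply/uniq_countP => t; have := u t => /=; lia.
move=> /(_ uy isT) cx.
apply: (@no_descent_to_branch x x' p w v) => //; [by rewrite adjC|lia|].
by apply/uniq_countP => t; have := u t => /=; lia.
Qed.

(** Strict concavity along the arm: the extremal profile falls linearly from [c z] to zero in [p.+2]
    steps. *)
Lemma arm_weight z a s p : path (adj C) z (a :: s) -> uniq [:: z, a & s] ->
  p <= size s -> p.+1 * c z < p.+2 * c a.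
Proof.
elim: s z a p => [|b s IH] z a [|p] //= pz uz ps.
- have := @subadd_seq a [:: z]; rewrite /= big_seq1 adjC.
  by case/andP: pz => -> _ /(_ isT isT); lia.
- have := @subadd_seq a [:: z]; rewrite /= big_seq1 adjC.
  by case/andP: pz => -> _ /(_ isT isT); lia.
case/and3P: pz => za ab pb; case/and3P: uz => nz na ub.
have := IH a b p; rewrite /= ab pb na ub => /(_ isT isT ps).
have := @subadd_seq a [:: z; b]; rewrite /= !big_cons big_nil [adj C a z]adjC za ab.
have zb : z != b by move: nz; rewrite !inE !negb_or => /and3P[].
by rewrite inE zb => /(_ isT isT); nia.
Qed.

(** Arms are read outward from the centre [z], which lies on none of them; they may be empty. *)
Definition tripod z s1 s2 s3 :=
  [/\ path (adj C) z s1, path (adj C) z s2, path (adj C) z s3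
    & uniq (z :: s1 ++ s2 ++ s3)].

Definition nonempty (T : Type) (s : seq T) := 0 < size s.

Lemma tripod_swap12 z s1 s2 s3 : tripod z s1 s2 s3 -> tripod z s2 s1 s3.
Proof.
case=> ? ? ? /uniq_countP u; split=> //; apply/uniq_countP => t.
by have := u t; rewrite /= !count_cat; lia.
Qed.

Lemma tripod_swap23 z s1 s2 s3 : tripod z s1 s2 s3 -> tripod z s1 s3 s2.
Proof.
case=> ? ? ? /uniq_countP u; split=> //; apply/uniq_countP => t.
by have := u t; rewrite /= !count_cat; lia.
Qed.

Lemma tripod_weights z s1 s2 s3 : tripod z s1 s2 s3 ->
  nonempty s1 -> nonempty s2 -> nonempty s3 ->
  exists a1 a2 a3, [/\ a1 + a2 + a3 < 2 * c z,
    forall p, p < size s1 -> p.+1 * c z < p.+2 * a1,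
    forall p, p < size s2 -> p.+1 * c z < p.+2 * a2
  & forall p, p < size s3 -> p.+1 * c z < p.+2 * a3].
Proof.
case: s1 s2 s3 => [|a1 s1] [|a2 s2] [|a3 s3] // [p1 p2 p3 /uniq_countP u] _ _ _.
have u1 : uniq [:: z, a1 & s1].
  by apply/uniq_countP => t; have := u t; rewrite /= !count_cat /= ?count_cat /=; lia.
have u2 : uniq [:: z, a2 & s2].
  by apply/uniq_countP => t; have := u t; rewrite /= !count_cat /= ?count_cat /=; lia.
have u3 : uniq [:: z, a3 & s3].
  by apply/uniq_countP => t; have := u t; rewrite /= !count_cat /= ?count_cat /=; lia.
have ua : uniq [:: a1; a2; a3].
  by apply/uniq_countP => t; have := u t; rewrite /= !count_cat /= ?count_cat /=; lia.
exists (c a1), (c a2), (c a3); split=> [|p|p|p]; rewrite ?ltnS.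
- have := @subadd_seq z _ ua; rewrite /= !big_cons big_nil.
  by move: p1 p2 p3 => /= /andP[-> _] /andP[-> _] /andP[-> _] /(_ isT); lia.
- exact: arm_weight.
- exact: arm_weight.
- exact: arm_weight.
Qed.

(* Excludes the affine diagrams E6~, E7~ and E8~. *)
Lemma tripod_sizes z s1 s2 s3 : tripod z s1 s2 s3 ->
  nonempty s1 -> nonempty s2 -> nonempty s3 ->
  [/\ ~~ [&& 1 < size s1, 1 < size s2 & 1 < size s3],
      ~~ [&& 2 < size s1 & 2 < size s2]
    & ~~ [&& 4 < size s1 & 1 < size s2]].
Proof.
move=> t n1 n2 n3; have [a1 [a2 [a3 [a b1 b2 b3]]]] := tripod_weights t n1 n2 n3.
split; apply/negP.
(* In units of [c z], the strict lower bounds on the three arm heads add up to 2 in each case: 2/3 +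
   2/3 + 2/3, then 3/4 + 3/4 + 1/2, then 5/6 + 2/3 + 1/2. *)
- by move=> /and3P[/b1 ? /b2 ? /b3 ?]; lia.
- by move=> /andP[/b1 ? /b2 ?]; have := b3 0 n3; lia.
- by move=> /andP[/b1 ? /b2 ?]; have := b3 0 n3; lia.
Qed.

(** A new neighbour of the last arm vertex would extend the arm; at an earlier vertex it would
    create a second branching besides the one at [z]. *)
Lemma tripod_arm_closed z s1 s2 s3 u v : tripod z s1 s2 s3 ->
  nonempty s2 -> nonempty s3 -> (forall v, ~ tripod z (rcons s1 v) s2 s3) ->
  u \in s1 -> adj C u v -> v \in z :: s1 ++ s2 ++ s3.
Proof.
case: s2 s3 => [|h2 t2] [|h3 t3] // [p1 p2 p3 uT] _ _ maxs us uv.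
apply: contraT => vT.
have /uniq_countP {vT uT} u' : uniq (v :: z :: s1 ++ (h2 :: t2) ++ h3 :: t3).
  by rewrite cons_uniq vT.
move: us p1 maxs u'; case/splitPr=> a [|w b] p1 maxs u'.
  case: (maxs v); split=> //.
    rewrite cats1 rcons_path -cats1 p1 last_cat /=; exact: uv.
  by apply/uniq_countP => t; have := u' t; rewrite /= -cats1 !count_cat /= !count_cat /=; lia.
move: p1; rewrite -cat_rcons cat_path last_rcons /= => /and3P[pa uw _].
case: (@no_double_branch h2 h3 z (rcons a u) w v) => //.
- by case/andP: p2.
- by case/andP: p3.
- apply/uniq_countP => t; have := u' t.
  by rewrite /= !count_cat /= !count_cat /= -cats1 !count_cat /=; lia.
- by rewrite last_rcons.
- by rewrite last_rcons.
Qed.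

(** A fourth neighbour of [z] would give D4~, a double branching with both branch points equal. *)
Lemma tripod_center_closed z s1 s2 s3 v : tripod z s1 s2 s3 ->
  nonempty s1 -> nonempty s2 -> nonempty s3 -> adj C z v ->
  v \in z :: s1 ++ s2 ++ s3.
Proof.
case: s1 s2 s3 => [|h1 t1] [|h2 t2] [|h3 t3] // [p1 p2 p3 uT] _ _ _ zv.
apply: contraT => vT.
have /uniq_countP {vT uT} u' : uniq (v :: z :: (h1 :: t1) ++ (h2 :: t2) ++ h3 :: t3).
  by rewrite cons_uniq vT.
move: p1 p2 p3 => /= /andP[zh1 _] /andP[zh2 _] /andP[zh3 _].
case: (@no_double_branch h1 h2 z [::] h3 v) => //.
apply/uniq_countP => t; have := u' t.
by rewrite /= !count_cat /= !count_cat /=; lia.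
Qed.

(** * Identification of components with Dynkin diagrams *)

Lemma sorted_two_arms z s1 s2 :
  path (adj C) z s1 -> path (adj C) z s2 -> sorted (adj C) (rev s1 ++ z :: s2).
Proof.
move=> p1 p2; rewrite -cat_rcons -rev_cons.
have : sorted (adj C) (rev (z :: s1)).
  rewrite rev_sorted (@eq_sorted _ _ (adj C)) // => x y; exact: adjC.
rewrite rev_cons headI /= cat_path => ->.
by rewrite -(last_cons z) -headI last_rcons.
Qed.

(** Two arms unroll into one path with [z] at position [size s1]; the one-vertex arm [y] comes last,
    as in [adj_branch]. *)
Lemma branch_adj z s1 s2 y (n := size s1 + size s2 + 2)
    (T := (rev s1 ++ z :: s2) ++ [:: y]) (i j : 'I_n) :
  tripod z s1 s2 [:: y] ->
  adj C (nth z T i) (nth z T j) = adj_branch (size s1) i j.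
Proof.
case=> p1 p2 p3 /uniq_countP u.
set L := rev s1 ++ z :: s2.
have sizeL : size L = n.-1 by rewrite /L size_cat size_rev /= /n; lia.
have sL : sorted (adj C) L by exact: sorted_two_arms.
have uL : uniq L.
  apply/uniq_countP => t; have := u t.
  by rewrite /L /= !count_cat count_rev /=; lia.
have nL (k : nat) : k < n.-1 -> nth z T k = nth z L k.
  by rewrite -sizeL /T nth_cat => ->.
have ny : nth z T n.-1 = y by rewrite /T nth_cat sizeL ltnn subnn.
have zy : adj C z y by case/andP: p3.
have Ly (k : nat) : k < n.-1 -> adj C (nth z L k) y = (k == size s1).
  move=> kn; have nz : nth z L (size s1) = z.
    by rewrite /L nth_cat size_rev ltnn subnn.
  case: eqP => [->|/eqP nk]; first by rewrite nz.
  have : nth z L k != z.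
    rewrite -[X in _ != X]nz nth_uniq ?sizeL //.
    by rewrite /n; lia.
  have : nth z L k \in L by rewrite mem_nth ?sizeL.
  (* A neighbour of [y] on an arm would give a chord of the path from [y] through [z] along that
     arm. *)
  rewrite adjC [_ \in L]mem_cat mem_rev inE => /or3P[ks|/eqP->|ks]; rewrite ?eqxx // => _.
    apply: (@path_no_chord _ z s1) => //; first by rewrite /= adjC zy.
    by apply/uniq_countP => t; have := u t; rewrite /= !count_cat /=; lia.
  apply: (@path_no_chord _ z s2) => //; first by rewrite /= adjC zy.
  by apply/uniq_countP => t; have := u t; rewrite /= !count_cat /=; lia.
have n2 : n.-1 = n - 1 /\ 2 <= n by rewrite /n; lia.
have s1n : size s1 < n.-1 by rewrite /n; lia.
rewrite /adj_branch.
case: (ltnP i n.-1) (ltn_ord i) => [iL _|iL ltin];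
  case: (ltnP j n.-1) (ltn_ord j) => [jL _|jL ltjn].
- rewrite !nL // line_adj ?sizeL //; lia.
- have -> : nth z T j = y by rewrite -ny; congr nth; lia.
  by rewrite nL // Ly //; lia.
- have -> : nth z T i = y by rewrite -ny; congr nth; lia.
  by rewrite nL // adjC Ly //; lia.
- have -> : nth z T i = y by rewrite -ny; congr nth; lia.
  have -> : nth z T j = y by rewrite -ny; congr nth; lia.
  by rewrite adj_irr; lia.
Qed.

Lemma component_refl x : component C x x.
Proof. by exists [::]. Qed.

Lemma component_adj x y z : component C x y -> adj C y z -> component C x z.
Proof.
by move=> [p [px <-]] yz; exists (rcons p z); rewrite rcons_path last_rcons px.
Qed.

Lemma component_trans x y z :
  component C x y -> component C y z -> component C x z.
Proof.
move=> [p [px <-]] [q [qy <-]].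
by exists (p ++ q); rewrite cat_path last_cat px.
Qed.

Lemma component_path x y p : component C x y -> path (adj C) y p ->
  {in p, forall z, component C x z}.
Proof.
elim: p y => // z p IH y xy /= /andP[yz pz] w; rewrite inE => /orP[/eqP->|wp].
  exact: component_adj yz.
exact: IH (component_adj xy yz) pz _ wp.
Qed.

Lemma component_closed (T : seq V) x : x \in T ->
  (forall u v, u \in T -> adj C u v -> v \in T) ->
  forall y, component C x y -> y \in T.
Proof.
move=> + clT y [p [+ <-]]; elim: p x => //= z p IH x xT /andP[xz pz].
exact: IH (clT _ _ xT xz) pz.
Qed.

Lemma component_sym x y : component C x y -> component C y x.
Proof.
move=> [p [px <-]]; elim: p x px => [|z p IH] x /=.
  by move=> _; exact: component_refl.
by move=> /andP[xz /IH lz]; apply: component_adj lz _; rewrite adjC.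
Qed.

Lemma induced_iso_seq x0 (T : seq V) x n (e : rel 'I_n) : uniq T -> size T = n ->
  (forall y, component C x y <-> y \in T) ->
  (forall i j : 'I_n, adj C (nth x0 T i) (nth x0 T j) = e i j) ->
  induced_iso C (component C x) e.
Proof.
move=> uT sT xT ee; exists (fun i : 'I_n => nth x0 T i); split=> //.
  move=> i j /eqP; rewrite nth_uniq ?sT ?ltn_ord // => /eqP ij.
  exact: val_inj.
apply/seteqP; split => y /=.
  by move=> [i _ <-]; apply/xT; rewrite mem_nth // sT.
move=> /xT yT; have iT : index y T < n by rewrite -sT index_mem.
by exists (Ordinal iT) => //=; rewrite nth_index.
Qed.

Definition dynkin_component x :=
  exists n (e : rel 'I_n), dynkin_diagram e /\ induced_iso C (component C x) e.

Lemma line_component x L : sorted (adj C) L -> uniq L ->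
  (forall y, component C x y <-> y \in L) -> dynkin_component x.
Proof.
move=> sL uL xL; exists (size L), (@adjA (size L)); split.
  constructor; have /xL := component_refl x.
  by case: L {sL uL xL}.
by apply: (induced_iso_seq (x0 := x) uL) => // i j; rewrite line_adj.
Qed.

Lemma branch_component x z s1 s2 y : tripod z s1 s2 [:: y] ->
  (forall v, component C x v <-> v \in z :: s1 ++ s2 ++ [:: y]) ->
  induced_iso C (component C x) (@adj_branch (size s1 + size s2 + 2) (size s1)).
Proof.
move=> t xT; pose T := (rev s1 ++ z :: s2) ++ [:: y].
apply: (@induced_iso_seq z T).
- case: t => _ _ _ /uniq_countP u; apply/uniq_countP => w; have := u w.
  by rewrite /T /= !count_cat count_rev /=; lia.
- by rewrite /T !size_cat size_rev /=; lia.
- move=> v; rewrite xT /T !(inE, mem_cat, mem_rev).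
  by case: (v == z); do !case: (_ \in _); case: (v == y); rewrite ?orbT.
- by move=> i j; exact: branch_adj.
Qed.

(** The size constraints force [size s3 = 1], and then either [size s2 = 1], which is type D, or
    [size s2 = 2] with [size s1] equal to 2, 3 or 4, which is type E. *)
Lemma tripod_component_sorted x z s1 s2 s3 : tripod z s1 s2 s3 ->
  nonempty s3 -> size s3 <= size s2 <= size s1 ->
  (forall v, component C x v <-> v \in z :: s1 ++ s2 ++ s3) ->
  dynkin_component x.
Proof.
move=> t n3 /andP[s32 s21] xT.
have n2 : nonempty s2 by apply: leq_trans s32.
have n1 : nonempty s1 by apply: leq_trans s21.
have [E6 E7 E8] := tripod_sizes t n1 n2 n3.
have {n3 E6} s3E : size s3 = 1 by move: n3 E6; rewrite /nonempty; lia.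
case: s3 s3E s32 t xT => [|y [|]] // _ s32 t xT.
have [s2E|s2n] := eqVneq (size s2) 1.
  have := branch_component t xT; rewrite s2E => iso.
  exists (size s1 + 1 + 2), (@adj_branch (size s1 + 1 + 2) (size s1)); split=> //.
  have n4 : 4 <= size s1 + 1 + 2 by move: n1; rewrite /nonempty; lia.
  by have := DynkinD n4; have -> : size s1 + 1 + 2 - 3 = size s1 by lia.
have s2E : size s2 = 2 by move: n2; rewrite /nonempty; lia.
(* The arm of length 2 is put first so that the centre gets number 2, as in the E diagrams. *)
have := @branch_component x z s2 s1 y (tripod_swap12 t).
rewrite s2E => iso.
exists (2 + size s1 + 2), (@adj_branch (2 + size s1 + 2) 2); split.
  have : size s1 \in [:: 2; 3; 4] by rewrite !inE; lia.
  by rewrite !inE => /or3P[] /eqP ->; constructor.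
apply: iso => v; rewrite xT !(inE, mem_cat).
by do !case: (_ \in _); rewrite ?orbT.
Qed.

Lemma tripod_component x z s1 s2 s3 : tripod z s1 s2 s3 ->
  nonempty s1 -> nonempty s2 -> nonempty s3 ->
  (forall v, component C x v <-> v \in z :: s1 ++ s2 ++ s3) ->
  dynkin_component x.
Proof.
wlog s32 : s2 s3 / size s3 <= size s2.
  move=> W t n1 n2 n3 xT; case: (leqP (size s3) (size s2)) => [|/ltnW] s23.
    exact: (W s2 s3).
  apply: (W s3 s2) => //; first exact: tripod_swap23.
  by move=> v; rewrite xT !(inE, mem_cat); do !case: (_ \in _); rewrite ?orbT.
wlog s31 : s1 s3 s32 / size s3 <= size s1.
  move=> W t n1 n2 n3 xT; case: (leqP (size s3) (size s1)) => [|/ltnW] s13.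
    exact: (W s1 s3).
  apply: (W s3 s1) => //; first by lia.
    exact/tripod_swap23/tripod_swap12/tripod_swap23.
  by move=> v; rewrite xT !(inE, mem_cat); do !case: (_ \in _); rewrite ?orbT.
move=> t n1 n2 n3 xT; case: (leqP (size s2) (size s1)) => [|/ltnW] s12.
  by apply: (tripod_component_sorted t) => //; rewrite s32.
apply: (tripod_component_sorted (tripod_swap12 t)) => //; first by rewrite s31.
by move=> v; rewrite xT !(inE, mem_cat); do !case: (_ \in _); rewrite ?orbT.
Qed.

Lemma tripod_closed z s1 s2 s3 : tripod z s1 s2 s3 ->
  nonempty s1 -> nonempty s2 -> nonempty s3 ->
  (forall s1' s2' s3', tripod z s1' s2' s3' ->
     nonempty s1' -> nonempty s2' -> nonempty s3' ->
     size s1' + size s2' + size s3' <= size s1 + size s2 + size s3) ->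
  forall u v, u \in z :: s1 ++ s2 ++ s3 -> adj C u v -> v \in z :: s1 ++ s2 ++ s3.
Proof.
move=> t n1 n2 n3 maxt u v.
rewrite inE !mem_cat => /or4P[/eqP->|us|us|us] uv.
- exact: tripod_center_closed uv.
- apply: tripod_arm_closed us uv => // w tw.
  by have := maxt _ _ _ tw; rewrite /nonempty size_rcons => /(_ isT n2 n3); lia.
- suff : v \in z :: s2 ++ s1 ++ s3.
    by rewrite !(inE, mem_cat); do !case: (_ \in _); rewrite ?orbT.
  apply: tripod_arm_closed us uv => //; first exact: tripod_swap12.
  move=> w /tripod_swap12 tw.
  by have := maxt _ _ _ tw; rewrite /nonempty size_rcons => /(_ n1 isT n3); lia.
- suff : v \in z :: s3 ++ s1 ++ s2.
    by rewrite !(inE, mem_cat); do !case: (_ \in _); rewrite ?orbT.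
  apply: tripod_arm_closed us uv => //; first exact/tripod_swap12/tripod_swap23.
  move=> w /tripod_swap12/tripod_swap23 tw.
  by have := maxt _ _ _ tw; rewrite /nonempty size_rcons => /(_ n1 n2 isT); lia.
Qed.

(** A tripod at [z] of largest total size is closed under adjacency, so it fills the component. *)
Lemma dynkin_component_of_tripod x z s1 s2 s3 : component C x z ->
  tripod z s1 s2 s3 -> nonempty s1 -> nonempty s2 -> nonempty s3 ->
  dynkin_component x.
Proof.
move=> xz t0 n10 n20 n30.
pose P (s : seq V * seq V * seq V) := [/\ tripod z s.1.1 s.1.2 s.2,
  nonempty s.1.1, nonempty s.1.2 & nonempty s.2].
have P0 : P (s1, s2, s3) by [].
have bound s : P s -> size s.1.1 + size s.1.2 + size s.2 <= size E.
  case=> -[_ _ _ /andP[_ u] _ _ _].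
  by rewrite -!size_cat -catA uniq_leq_size // => w _; exact: memE.
have [[[r1 r2] r3] [t n1 n2 n3] maxP] := exists_max P0 bound.
apply: (tripod_component t) => // v; split.
  move=> xv; apply: (@component_closed _ x) xv.
    apply: (@component_closed _ z (mem_head _ _)) (component_sym xz).
    apply: tripod_closed => // s1' s2' s3' t' n1' n2' n3'.
    exact: (maxP (s1', s2', s3')).
  apply: tripod_closed => // s1' s2' s3' t' n1' n2' n3'.
  exact: (maxP (s1', s2', s3')).
case: t => p1 p2 p3 _; rewrite inE !mem_cat => /or4P[/eqP->//|||] vs.
- exact: component_path xz p1 _ vs.
- exact: component_path xz p2 _ vs.
- exact: component_path xz p3 _ vs.
Qed.

(** Without tripods, a longest path through [x] fills the component: an outside neighbour of an end
    vertex would lengthen it, and one of an inner vertex would give a tripod. *)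
Lemma dynkin_component_subadditive x : dynkin_component x.
Proof.
have [[z [s1 [s2 [s3 [xz t n1 [n2 n3]]]]]]|no_tripod] := pselect (exists z s1 s2 s3,
    [/\ component C x z, tripod z s1 s2 s3, nonempty s1 & nonempty s2 /\ nonempty s3]).
  exact: dynkin_component_of_tripod xz t n1 n2 n3.
pose P L := [/\ sorted (adj C) L, uniq L & x \in L].
have P0 : P [:: x] by rewrite /P mem_head.
have bound L : P L -> size L <= size E.
  by case=> _ uL _; apply: uniq_leq_size => // w _; exact: memE.
have [L [sL uL xL] maxL] := exists_max P0 bound.
have Lx u : u \in L -> component C x u.
  case: L sL xL {uL maxL} => // w p pw xL uL.
  have wp y : y \in w :: p -> component C w y.
    rewrite inE => /orP[/eqP->|]; first exact: component_refl.
    by apply: component_path pw _; exact: component_refl.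
  exact: component_trans (component_sym (wp _ xL)) (wp _ uL).
apply: (line_component sL uL) => y; split; last exact: Lx.
apply: component_closed => // u v uL' uv; apply: contraT => vL.
have uvL : uniq (v :: L) by rewrite /= vL.
have xu := Lx u uL'; move: uL' sL uvL xL maxL.
case/splitPr => a b sL /uniq_countP uvL xL maxL.
have pb : path (adj C) u b by move: sL; rewrite sorted_cat_cons => /andP[].
have pa : path (adj C) u (rev a).
  move: sL; rewrite sorted_cat_cons -rev_sorted rev_rcons => /andP[+ _].
  by rewrite /= (@eq_path _ _ (adj C)) // => ? ?; exact: adjC.
case: (posnP (size a)) => [/size0nil a0|a0].
  have /maxL : P (v :: a ++ u :: b); last by rewrite /= ltnn.
  split; [by rewrite a0 /= adjC uv| |by rewrite inE xL orbT].
  exact/uniq_countP.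
case: (posnP (size b)) => [/size0nil b0|b0].
  (* The path is reversed so that its last vertex [u] comes first and [v] can be prepended. *)
  have /maxL : P (v :: u :: rev a); last by rewrite b0 size_cat /= size_rev addn1 ltnn.
  split; first by rewrite /= adjC uv.
    apply/uniq_countP => w; have := uvL w.
    by rewrite /= count_cat count_rev /=; lia.
  by move: xL; rewrite b0 mem_cat !inE mem_rev orbC => ->; rewrite orbT.
case: no_tripod; exists u, (rev a), b, [:: v]; split=> //.
- split=> //; first by rewrite /= uv.
  apply/uniq_countP => w; have := uvL w.
  by rewrite /= !count_cat count_rev /=; lia.
- by rewrite /nonempty size_rev.
Qed.

End Subadditive.

Lemma dynkin_of_finite_type (V : choiceType) (Q : digraph V) :
  finite_type Q -> dynkin (remove_arrows Q).
Proof.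
move=> finQ; have finV := finite_vertices finQ; split=> // x.
have [E uE memE] := finite_set_enum finV.
have [c subadd] := subadditive_of_finite_type uE memE finQ.
exact: (@dynkin_component_subadditive _ (remove_arrows Q) E c uE memE subadd).
Qed.

Theorem corollary2p2 :
  (forall (V : choiceType) (C : sgraph V) (Q : digraph V),
      dynkin C -> orientation_of C Q -> finite_type Q) /\
  (forall (V : choiceType) (Q : digraph V),
      finite_type Q -> dynkin (remove_arrows Q)).
Proof.
split=> [V C Q dynC oriQ|V Q].
  exact: finite_type_of_dynkin dynC oriQ.
exact: dynkin_of_finite_type.
Qed.
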